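(* Let $\Gamma$ be a connected metric graph (every edge of length $1$). If $\pi(\Gamma)>10$, then $\Gamma$ is (Gromov) hyperbolic.
   Context: A metric graph is a one-dimensional connected CW-complex equipped with the path metric in which every edge has length $1$ (loops and multiple edges are allowed). For a closed geodesic interval $I=[x,z]$ in $\Gamma$ (the image of a geodesic path from $x$ to $z$) of length $\ell_I$, put $r_I=\ell_I/2$ and let $B_I$ be the open ball of radius $r_I$ centered at the midpoint $y$ of $I$. Let $\Delta_I$ be the set of rectifiable curves in $\Gamma$ that join the endpoints $x,z$ of $I$ and do not intersect $B_I$. Define $$\pi(I)=\frac{\inf\{\mathrm{length}(\gamma):\gamma\in\Delta_I\}}{r_I},$$ with $\pi(I)=\infty$ if $\Delta_I=\varnothing$. Define $\pi(\Gamma)=\liminf_{\ell_I\to\infty}\pi(I)$, the lower limit being taken over all closed geodesic intervals $I$ in $\Gamma$ as their length tends to infinity, with $\pi(\Gamma)=\infty$ if $\Gamma$ is bounded. *)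

(* Defs.v *)
From HB Require Import structures.
From Stdlib Require Import Relation_Operators.
From mathcomp Require Import all_boot all_order all_algebra.
From mathcomp Require Import lra.
From mathcomp Require Import all_classical all_reals all_analysis.

Set Implicit Arguments.
Unset Strict Implicit.
Unset Printing Implicit Defensive.

Import Order.TTheory GRing.Theory Num.Theory.
Import numFieldNormedType.Exports.

Local Open Scope classical_set_scope.
Local Open Scope ring_scope.

(* Loops ([src e = tgt e]), multiple edges, infinitely many vertices and edges
   and vertices of infinite degree are all allowed.  The orientation of an edge
   only serves to parametrize it. *)
Record connected_graph := ConnectedGraph {
  vertex : Type;
  edge : Type;
  src : edge -> vertex;
  tgt : edge -> vertex;
  graph_connected : forall u v : vertex,
    clos_refl_sym_trans vertex
      (fun x y => exists e : edge, src e = x /\ tgt e = y) u v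
}.

(* The points of the 1-dimensional CW-complex: its 0-cells, and its open
   1-cells, each a copy of ]0, 1[. *)
Inductive metric_graph (R : realType) (G : connected_graph) : Type :=
| Vertex of vertex G
| Inner of edge G & {t : R | 0 < t < 1}.

Section PathMetric.
Context {R : realType} {G : connected_graph}.
Implicit Types (p q : metric_graph R G) (e : edge G) (s t : R).
Implicit Types l : seq (edge G * R * R).

HB.instance Definition _ := gen_eqMixin (metric_graph R G).
HB.instance Definition _ := gen_choiceMixin (metric_graph R G).

(* The characteristic map [0, 1] -> G of the edge e. *)
Definition edge_pt e t : metric_graph R G :=
  if insub t is Some u then Inner e u
  else Vertex R (if t <= 0 then src e else tgt e).

(* The list l of triples (e, s, t) describes a piecewise linear path from p to
   q which successively runs, inside each edge e, from parameter s to t. *)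
Fixpoint pl_path p l q : Prop :=
  if l is (e, s, t) :: l' then
    [/\ 0 <= s <= 1, 0 <= t <= 1, p = edge_pt e s & pl_path (edge_pt e t) l' q]
  else p = q.

Definition pl_length l : R := \sum_(c <- l) `|c.1.2 - c.2|.

(* The path metric for which every edge has length 1. *)
Definition path_dist p q : R :=
  inf [set pl_length l | l in [set l | pl_path p l q]].

Lemma edge_pt0 e : edge_pt e 0 = Vertex R (src e).
Proof. by rewrite /edge_pt insubF ?ltxx// lexx. Qed.

Lemma edge_pt1 e : edge_pt e 1 = Vertex R (tgt e).
Proof. by rewrite /edge_pt insubF ?ltxx ?andbF// ler10. Qed.

Lemma edge_ptP (P : R -> metric_graph R G -> Prop) e :
  P 0 (Vertex R (src e)) -> P 1 (Vertex R (tgt e)) ->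
  (forall u : {t : R | 0 < t < 1}, P (val u) (Inner e u)) ->
  forall t, 0 <= t <= 1 -> P t (edge_pt e t).
Proof.
move=> P0 P1 PI t /andP[t0 t1]; rewrite /edge_pt.
case: insubP => [u _ <-//|]; rewrite negb_and -!leNgt => /orP[t0'|t1'].
  by rewrite t0'; have -> : t = 0 by apply/eqP; rewrite eq_le t0 t0'.
have -> : t = 1 by apply/eqP; rewrite eq_le t1 t1'.
by rewrite ler10.
Qed.

Lemma edge_pt_inner e (u : {t : R | 0 < t < 1}) : edge_pt e (val u) = Inner e u.
Proof. by rewrite /edge_pt valK. Qed.

Lemma pl_path_cat p q r l1 l2 :
  pl_path p l1 q -> pl_path q l2 r -> pl_path p (l1 ++ l2) r.
Proof.
elim: l1 p => [p ->//|[[e s] t] l1 ih p /= [s01 t01 -> h1] h2].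
by split => //; exact: ih.
Qed.

Lemma pl_length_cat l1 l2 : pl_length (l1 ++ l2) = pl_length l1 + pl_length l2.
Proof. by rewrite /pl_length big_cat. Qed.

Lemma pl_path_rev p q l : pl_path p l q ->
  exists2 l', pl_path q l' p & pl_length l' = pl_length l.
Proof.
elim: l p => [p ->|[[e s] t] l ih p /= [s01 t01 -> /ih[l' h' ll']]].
  by exists [::].
exists (l' ++ [:: (e, t, s)]).
  by apply: pl_path_cat h' _.
by rewrite pl_length_cat ll' /pl_length !big_cons big_nil/= addr0 addrC distrC.
Qed.

Lemma pl_length_ge0 l : 0 <= pl_length l.
Proof. by rewrite /pl_length sumr_ge0. Qed.

Lemma pl_path_ex p q : exists l, pl_path p l q.
Proof.
have trans p1 p2 p3 : (exists l, pl_path p1 l p2) ->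
    (exists l, pl_path p2 l p3) -> exists l, pl_path p1 l p3.
  by move=> [l1 h1] [l2 h2]; exists (l1 ++ l2); apply: pl_path_cat h1 h2.
have sym p1 p2 : (exists l, pl_path p1 l p2) -> exists l, pl_path p2 l p1.
  by move=> [l /pl_path_rev[l' h _]]; exists l'.
have toV p1 : exists v, exists l, pl_path p1 l (Vertex R v).
  case: p1 => [v|e u]; first by exists v, [::].
  have /andP[u0 u1] := valP u.
  exists (src e), [:: (e, val u, 0)] => /=.
  by rewrite edge_pt_inner edge_pt0 lexx ler01 (ltW u0) (ltW u1).
have [v pv] := toV p; have [w /sym qw] := toV q.
apply: (trans _ _ _ pv); apply: (trans _ _ _ _ qw).
elim: (graph_connected v w) => {v w qw pv}.
- move=> _ _ [e [<- <-]]; exists [:: (e, 0, 1)] => /=.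
  by rewrite edge_pt0 edge_pt1 !lexx !ler01.
- by move=> x; exists [::].
- by move=> x y _; exact: sym.
- by move=> x y z _ xy _ yz; exact: (trans _ _ _ xy yz).
Qed.

Lemma path_dist_le p q l : pl_path p l q -> path_dist p q <= pl_length l.
Proof.
move=> h; apply: ge_inf; last by exists l.
by exists 0 => _ [l' _ <-]; exact: pl_length_ge0.
Qed.

Lemma le_path_dist p q x :
  (forall l, pl_path p l q -> x <= pl_length l) -> x <= path_dist p q.
Proof.
move=> h; apply: lb_le_inf; last by move=> _ [l hl <-]; exact: h.
by have [l hl] := pl_path_ex p q; exists (pl_length l), l.
Qed.

Lemma path_dist_ge0 p q : 0 <= path_dist p q.
Proof. by apply: le_path_dist => l _; exact: pl_length_ge0. Qed.

Lemma path_distxx p : path_dist p p = 0.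
Proof.
apply/eqP; rewrite eq_le path_dist_ge0 andbT.
rewrite (le_trans (@path_dist_le p p [::] erefl))//.
by rewrite /pl_length big_nil.
Qed.

Lemma path_dist_sym p q : path_dist p q = path_dist q p.
Proof.
apply/eqP; rewrite eq_le; apply/andP; split; apply: le_path_dist => l;
by move=> /pl_path_rev[l' h <-]; exact: path_dist_le.
Qed.

Lemma path_dist_triangle q p r :
  path_dist p r <= path_dist p q + path_dist q r.
Proof.
rewrite -lerBlDr; apply: le_path_dist => l1 h1; rewrite lerBlDr -lerBlDl.
apply: le_path_dist => l2 h2; rewrite lerBlDl -pl_length_cat.
by apply: path_dist_le; exact: pl_path_cat h1 h2.
Qed.

Lemma path_dist_lip (f : metric_graph R G -> R) p q :
  (forall e s t, 0 <= s <= 1 -> 0 <= t <= 1 ->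
    f (edge_pt e t) - f (edge_pt e s) <= `|s - t|) ->
  f q - f p <= path_dist p q.
Proof.
move=> lip; apply: le_path_dist => l; elim: l p => [p ->|[[e s] t] l ih p /=].
  by rewrite subrr pl_length_ge0.
move=> [s01 t01 -> /ih h].
rewrite /pl_length big_cons /= -(subrK (f (edge_pt e t)) (f q)) -addrA addrC.
exact: lerD (lip _ _ _ s01 t01) h.
Qed.

Lemma path_dist_eq0 p q : path_dist p q = 0 -> p = q.
Proof.
move=> d0; apply: contrapT => pq.
suff [f lip] : exists2 f : metric_graph R G -> R,
    forall e s t, 0 <= s <= 1 -> 0 <= t <= 1 ->
      f (edge_pt e t) - f (edge_pt e s) <= `|s - t| & 0 < f q - f p.
  by apply/negP; rewrite -leNgt -d0; exact: path_dist_lip.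
case: p pq {d0} => [v|e0 u0] pq.
  pose g w : R := if `[< w = v >] then 0 else 1.
  have g01 w : g w = 0 \/ g w = 1 by rewrite /g; case: ifP; [left|right].
  pose f x := match x with
    | Vertex w => g w
    | Inner e u => Num.min (val u + g (src e)) (1 - val u + g (tgt e))
    end.
  have fE e : forall t, 0 <= t <= 1 ->
      f (edge_pt e t) = Num.min (t + g (src e)) (1 - t + g (tgt e)).
    apply: (edge_ptP (P := fun t x =>
      f x = Num.min (t + g (src e)) (1 - t + g (tgt e)))) => [||u]//=;
      rewrite minElt;
      by have [->|->] := g01 (src e); have [->|->] := g01 (tgt e);
         case: ltP => ?; lra.
  exists f.
    move=> e s t s01 t01; rewrite !fE// !minElt.
    by case: ltP => ?; case: ltP => ?; have [?|?] := ger0P (s - t); lra.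
  have -> : f (Vertex R v) = 0 by rewrite /= /g asboolT.
  rewrite subr0; case: q pq => [w vw|e [u u01] _] /=.
    by rewrite /g asboolF// => wv; apply: vw; rewrite wv.
  have /andP[u0 u1] := u01; rewrite lt_min; apply/andP.
  by have [->|->] := g01 (src e); have [->|->] := g01 (tgt e); split; lra.
have /andP[a0 a1] := valP u0; set a := val u0 in a0 a1.
pose eps := Num.min a (1 - a).
pose g e t := if `[< e = e0 >] then Num.min `|t - a| eps else eps.
pose f x := match x with Vertex w => eps | Inner e u => g e (val u) end.
have fE e : forall t, 0 <= t <= 1 -> f (edge_pt e t) = g e t.
  apply: (edge_ptP (P := fun t x => f x = g e t)) => [||u]//=; rewrite /g; case: ifP => // _.
    rewrite sub0r normrN gtr0_norm// /eps !minElt.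
    by case: ltP => ?; case: ltP => ?; lra.
  rewrite gtr0_norm ?subr_gt0// /eps !minElt.
  by case: ltP => ?; case: ltP => ?; lra.
exists f.
  move=> e s t s01 t01; rewrite !fE// /g; case: ifP => _.
    rewrite !minElt.
    have [?|?] := ger0P (s - t); have [?|?] := ger0P (s - a);
    have [?|?] := ger0P (t - a); case: ltP => ?; case: ltP => ?; lra.
  by rewrite subrr.
have eps0 : 0 < eps by rewrite lt_min a0 subr_gt0 a1.
have -> : f (Inner e0 u0) = 0.
  by rewrite /= /g asboolT// subrr normr0 minElt eps0.
rewrite subr0; case: q pq => [//|e u pq] /=; rewrite /g.
case: asboolP => // ee0; rewrite lt_min eps0 andbT normr_gt0 subr_eq0.
by apply/eqP => /val_inj uu0; apply: pq; rewrite ee0 uu0.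
Qed.

HB.instance Definition _ := @isMetric.Build R (metric_graph R G)
  path_dist path_distxx path_dist_eq0 path_dist_sym path_dist_triangle.

End PathMetric.

Section Geodesics.
Context {R : realType} {X : metricType R}.

(* The closed geodesic interval is the image of [0, gi_len] under gi_path; the
   values of gi_path outside [0, gi_len] are irrelevant. *)
Record geodesic_interval := GeodesicInterval {
  gi_len : R;
  gi_path : R -> X;
  gi_len_ge0 : 0 <= gi_len;
  gi_isometric : forall s t, s \in `[0, gi_len] -> t \in `[0, gi_len] ->
    mdist (gi_path s) (gi_path t) = `|s - t|
}.
Implicit Types I : geodesic_interval.

Definition gi_source I : X := gi_path I 0.
Definition gi_target I : X := gi_path I (gi_len I).
Definition gi_set I : set X := gi_path I @` `[0, gi_len I].
Definition gi_radius I : R := gi_len I / 2.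
Definition gi_midpoint I : X := gi_path I (gi_radius I).
Definition gi_ball I : set X := ball (gi_midpoint I) (gi_radius I).

(* Counterpart for metric spaces of [total_variation]. *)
Definition curve_length (a b : R) (c : R -> X) : \bar R :=
  ereal_sup [set (let F := c \o nth b (a :: s) in
                  \sum_(0 <= n < size s) mdist (F n) (F n.+1))%:E
            | s in itv_partition a b].

Record rectifiable_curve := RectifiableCurve {
  rc_start : R;
  rc_end : R;
  rc_map : R -> X;
  rc_le : rc_start <= rc_end;
  rc_continuous : {within `[rc_start, rc_end], continuous rc_map};
  rc_rectifiable : (curve_length rc_start rc_end rc_map < +oo)%E
}.

Definition rc_length (c : rectifiable_curve) : \bar R :=
  curve_length (rc_start c) (rc_end c) (rc_map c).

Definition detours I : set rectifiable_curve :=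
  [set c | [/\ rc_map c (rc_start c) = gi_source I,
               rc_map c (rc_end c) = gi_target I &
               rc_map c @` `[rc_start c, rc_end c] `&` gi_ball I = set0]].

(* [ereal_inf set0 = +oo], so that this is +oo if I has positive length and no
   detour.  The value at an interval of length 0 is irrelevant below. *)
Definition interval_pi I : \bar R :=
  (ereal_inf (rc_length @` detours I) * ((gi_radius I)^-1)%:E)%E.

End Geodesics.

Arguments geodesic_interval {R} X.
Arguments rectifiable_curve {R} X.

(* The lower limit of [interval_pi I] as [gi_len I] tends to infinity.  If the
   lengths of the geodesic intervals are bounded, which for a metric graph means
   that the graph is bounded, then [set0] is among the sets whose infimum is
   taken and the value is +oo. *)
Definition space_pi {R : realType} (X : metricType R) : \bar R :=
  ereal_sup [set ereal_inf [set interval_pi I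
                           | I in [set I : geodesic_interval X | L <= gi_len I]]
            | L in [set: R]].

(* Hyperbolicity of a geodesic space: geodesic triangles are uniformly slim.
   It suffices to consider the side I1, since the sides of a triangle can be
   permuted cyclically. *)
Definition gromov_hyperbolic {R : realType} (X : metricType R) : Prop :=
  exists2 delta : R, 0 <= delta &
    forall I1 I2 I3 : geodesic_interval X,
      gi_target I1 = gi_source I2 ->
      gi_target I2 = gi_source I3 ->
      gi_target I3 = gi_source I1 ->
      forall p, gi_set I1 p ->
        exists2 q, (gi_set I2 `|` gi_set I3) q & mdist p q <= delta.

(* Main.v *)
Require Import Defs.
From mathcomp Require Import all_boot all_order all_algebra.
From mathcomp Require Import ring lra.
From mathcomp Require Import all_classical all_reals all_analysis.

(* If a path stays D-far from a point p of a geodesic but D-close to the rest of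
   the geodesic, then leaving the geodesic at distance 2D on both sides of p and
   following the path gives a detour around the ball B(p, D).  When the path is
   almost geodesic this detour has length about 10 D, so the hypothesis forces
   almost geodesic bigons to be uniformly thin.  As in Papasoglu's theorem, thin
   almost geodesic bigons make geodesics issuing from a point and staying apart
   diverge to infinity (otherwise crossing from one to the other early or late
   would give a fat bigon), hence exponentially.  So detours around a ball of
   radius r are in fact longer than N r for every N and every large r.  With
   N = 23, the first argument applies to the (3, 2)-quasi-geodesics formed by a
   side of a triangle and a shortest path to the opposite vertex. *)

Set Implicit Arguments.
Unset Strict Implicit.
Unset Printing Implicit Defensive.

Import Order.TTheory GRing.Theory Num.Theory.
Import numFieldNormedType.Exports.

Local Open Scope classical_set_scope.
Local Open Scope ring_scope.

(** * Case analysis on absolute values and minima; growth estimates *)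

Lemma normr_cases {R : realDomainType} (x : R) :
  0 <= x /\ `|x| = x \/ x <= 0 /\ `|x| = - x.
Proof. by case: (ger0P x) => [|/ltW] x0; [left|right]. Qed.

Ltac norm_case x :=
  lazymatch goal with
  | _ : `|x| = _ |- _ => fail
  | _ => case: (normr_cases x) => -[? ?]
  end.

Ltac norm_lra := repeat match goal with
  | |- context [`|?x|] => norm_case x
  end; lra.

(** Innermost minima go first, so that each case split compares terms free of minima. *)
Ltac min_lra := repeat match goal with
  | |- context [Num.min ?a ?b] => lazymatch constr:((a, b)) with
    | context [Num.min _ _] => fail
    | _ => case: (leP a b) => ?
    end
  end; norm_lra.

Lemma minB_le {K : realDomainType} (x y x' y' d : K) :
  x' - x <= d -> y' - y <= d -> Num.min x' y' - Num.min x y <= d.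
Proof. by case: (leP x y) => ?; case: (leP x' y') => ? ? ?; lra. Qed.

Lemma sqr_le_exp2 {R : realType} n : (n.+1%:R ^+ 2 <= 4 * 2 ^+ n :> R).
Proof.
(* The ratio of consecutive squares drops below 2 only from 16/9 on, hence three base cases. *)
elim: n => [|[_|[_|n ih]]]; [rewrite expr0; lra|rewrite expr1; lra|lra|].
rewrite (exprS 2 n.+2); move: ih.
rewrite -(natr1 n.+3) -(natr1 n.+2) -(natr1 n.+1) -(natr1 n).
by have := ler0n R n; nra.
Qed.

(** Take [n] to be the integer part of [(r - b) / a]: then [c * r] is at most linear in [n.+1],
    while [2 ^+ n] is at least a quarter of its square. The threshold [m] on [n.+1] is where the
    square wins. *)
Lemma exp_growth {R : realType} (a b c : R) : 0 < a -> 0 <= b -> 0 <= c ->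
  exists r1, forall r, r1 <= r -> exists2 n, c * r <= 2 ^+ n & n%:R * a + b <= r.
Proof.
move=> a0 b0 c0; pose m := 4 * c * (b + a); exists (b + m * a) => r hr.
have m0 : 0 <= m by rewrite /m !mulr_ge0//; lra.
have ma0 : 0 <= m * a by rewrite mulr_ge0//; lra.
have q0 : 0 <= (r - b) / a by apply: divr_ge0; lra.
have := truncn_itv q0; set n := Num.trunc _ => /andP[nq qn].
exists n; last by move: nq; rewrite ler_pdivlMr//; lra.
have rn : r <= b + n.+1%:R * a by move: qn; rewrite ltr_pdivrMr//; lra.
have mn : m <= n.+1%:R by apply: le_trans (ltW qn); rewrite ler_pdivlMr//; lra.
have n1 : 1 <= n.+1%:R :> R by rewrite ler1n.
have := sqr_le_exp2 (R := R) n.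
have : m * n.+1%:R <= n.+1%:R ^+ 2 by rewrite expr2 ler_wpM2r//; lra.
have : c * r <= c * (b + n.+1%:R * a) by rewrite ler_wpM2l.
have : c * (b + n.+1%:R * a) <= c * ((b + a) * n.+1%:R).
  by rewrite ler_wpM2l//; nra.
by rewrite /m; lra.
Qed.

(** * 1-Lipschitz paths and geodesics in a metric space *)

Section Paths.
Context {R : realType} {X : metricType R}.
Implicit Types (g c : R -> X) (l L s t : R) (a b p : X) (S : set X).

(** Stands for a curve of length at most [L], without recourse to [curve_length]. *)
Definition short_path c L := forall s t, 0 <= s <= L -> 0 <= t <= L ->
  mdist (c s) (c t) <= `|s - t|.

Definition geodesic g l := forall s t, 0 <= s <= l -> 0 <= t <= l ->
  mdist (g s) (g t) = `|s - t|.

Definition path_cat c1 L1 c2 t := if t <= L1 then c1 t else c2 (t - L1).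

Definition joined S a b L := exists c,
  [/\ 0 <= L, short_path c L, c 0 = a, c L = b & forall t, 0 <= t <= L -> S (c t)].

Lemma geodesic_short g l : geodesic g l -> short_path g l.
Proof. by move=> h s t hs ht; rewrite h. Qed.

Lemma short_path_sub c L u v : 0 <= u -> v <= L -> short_path c L ->
  short_path (fun t => c (u + t)) (v - u).
Proof.
move=> u0 vL h s t hs ht; have := h (u + s) (u + t).
by rewrite (_ : u + s - (u + t) = s - t); [apply; lra|ring].
Qed.

Lemma geodesic_sub g l u v : 0 <= u -> v <= l -> geodesic g l ->
  geodesic (fun t => g (u + t)) (v - u).
Proof.
move=> u0 vl h s t hs ht; rewrite h; [|lra|lra].
by rewrite (_ : u + s - (u + t) = s - t)//; ring.
Qed.

Lemma short_path_rev c L u : u <= L -> short_path c L ->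
  short_path (fun t => c (u - t)) u.
Proof.
move=> uL h s t hs ht; have := h (u - s) (u - t).
by rewrite (_ : u - s - (u - t) = - (s - t)); [rewrite normrN; apply; lra|ring].
Qed.

Lemma geodesic_rev g l u : u <= l -> geodesic g l -> geodesic (fun t => g (u - t)) u.
Proof.
move=> ul h s t hs ht; rewrite h; [|lra|lra].
by rewrite (_ : u - s - (u - t) = - (s - t)) ?normrN//; ring.
Qed.

Lemma path_catl c1 L1 c2 t : t <= L1 -> path_cat c1 L1 c2 t = c1 t.
Proof. by rewrite /path_cat => ->. Qed.

Lemma path_catr c1 L1 c2 t : c1 L1 = c2 0 -> L1 <= t ->
  path_cat c1 L1 c2 t = c2 (t - L1).
Proof.
rewrite /path_cat => e tL; case: ifPn => // tL'.
by have -> : t = L1; [lra|rewrite subrr].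
Qed.

Lemma short_path_cat c1 L1 c2 L2 : short_path c1 L1 -> short_path c2 L2 ->
  c1 L1 = c2 0 -> short_path (path_cat c1 L1 c2) (L1 + L2).
Proof.
move=> h1 h2 e.
have main s t : 0 <= s -> s <= t -> t <= L1 + L2 ->
    mdist (path_cat c1 L1 c2 s) (path_cat c1 L1 c2 t) <= t - s.
  move=> s0 st tL.
  have [tL1|/ltW tL1] := leP t L1.
    rewrite !path_catl//; last by lra.
    by apply: le_trans (h1 _ _ _ _) _; [lra|lra|norm_lra].
  have [sL1|/ltW sL1] := leP s L1; rewrite (path_catr e tL1).
    rewrite path_catl//.
    apply: le_trans (metric_triangle _ (c1 L1) _) _.
    have h : mdist (c1 s) (c1 L1) <= `|s - L1| by apply: h1; lra.
    have h' : mdist (c1 L1) (c2 (t - L1)) <= `|0 - (t - L1)|.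
      by rewrite e; apply: h2; lra.
    by move: h h'; norm_lra.
  rewrite path_catr//.
  by apply: le_trans (h2 _ _ _ _) _; [lra|lra|norm_lra].
move=> s t hs ht; have [st|/ltW ts] := leP s t.
  by apply: le_trans (main _ _ _ _ _) _; [lra|lra|lra|norm_lra].
by rewrite metric_sym; apply: le_trans (main _ _ _ _ _) _; [lra|lra|lra|norm_lra].
Qed.

Lemma joined_cat S a p b L1 L2 : joined S a p L1 -> joined S p b L2 ->
  joined S a b (L1 + L2).
Proof.
move=> [c1 [L10 h1 c10 c1L S1]] [c2 [L20 h2 c20 c2L S2]].
have e : c1 L1 = c2 0 by rewrite c1L c20.
exists (path_cat c1 L1 c2); split; first by lra.
- exact: short_path_cat.
- by rewrite path_catl.
- by rewrite path_catr//; [rewrite addrAC subrr add0r|lra].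
- move=> t ht; have [tL1|/ltW tL1] := leP t L1.
    by rewrite path_catl//; apply: S1; lra.
  by rewrite path_catr//; apply: S2; lra.
Qed.

Lemma joined_sub S c L u v : short_path c L -> 0 <= u <= L -> 0 <= v <= L ->
  (forall w, u <= w <= v \/ v <= w <= u -> S (c w)) ->
  joined S (c u) (c v) `|u - v|.
Proof.
move=> h hu hv; have [uv|/ltW vu] := leP u v => hS.
  rewrite (_ : `|u - v| = v - u); last by norm_lra.
  exists (fun t => c (u + t)); split.
  - by lra.
  - by apply: short_path_sub h; lra.
  - by rewrite addr0.
  - by congr c; ring.
  - by move=> t ht; apply: hS; left; lra.
rewrite (_ : `|u - v| = u - v); last by norm_lra.
exists (fun t => c (u - t)); split.
- by lra.
- by move=> s t hs ht; apply: (short_path_rev _ h); lra.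
- by rewrite subr0.
- by congr c; ring.
- by move=> t ht; apply: hS; right; lra.
Qed.

Lemma joined_sym S a b L : joined S a b L -> joined S b a L.
Proof.
move=> [c [L0 h c0 cL hS]].
have := @joined_sub S c L L 0 h; rewrite c0 cL subr0 ger0_norm//; apply; try lra.
by move=> w hw; apply: hS; lra.
Qed.

Lemma geodesic_le g l l' : l' <= l -> geodesic g l -> geodesic g l'.
Proof. by move=> l'l h s t hs ht; apply: h; lra. Qed.

(** The two arcs outside [[s, t]] cannot gain on their parameter length, so no subarc wastes more
    than the whole path. *)
Lemma short_path_excess c L K : 0 <= L -> short_path c L ->
  L <= mdist (c 0) (c L) + K -> forall s t, 0 <= s <= L -> 0 <= t <= L ->
  `|s - t| <= mdist (c s) (c t) + K.
Proof.
move=> L0 h hL.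
have main s t : 0 <= s -> s <= t -> t <= L -> t - s <= mdist (c s) (c t) + K.
  move=> s0 st tL.
  have h1 : mdist (c 0) (c s) <= `|0 - s| by apply: h; lra.
  have h2 : mdist (c t) (c L) <= `|t - L| by apply: h; lra.
  have := metric_triangle (c 0) (c s) (c L).
  have := metric_triangle (c s) (c t) (c L).
  by move: h1 h2; norm_lra.
move=> s t hs ht; have [st|/ltW ts] := leP s t.
  by have : t - s <= mdist (c s) (c t) + K by [apply: main; lra]; norm_lra.
rewrite (metric_sym (c s)).
by have : s - t <= mdist (c t) (c s) + K by [apply: main; lra]; norm_lra.
Qed.

(** The parameter is the distance to the common origin, a 1-Lipschitz function. *)
Lemma geodesic_radial g l g' l' s t : geodesic g l -> geodesic g' l' ->
  g 0 = g' 0 -> 0 <= s <= l -> 0 <= t <= l' -> `|s - t| <= mdist (g s) (g' t).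
Proof.
move=> h h' e hs ht.
have ds : mdist (g 0) (g s) = s by rewrite h; [norm_lra|lra|lra].
have dt : mdist (g 0) (g' t) = t by rewrite e h'; [norm_lra|lra|lra].
have := metric_triangle (g 0) (g s) (g' t).
have := metric_triangle (g 0) (g' t) (g s).
by rewrite ds dt (metric_sym (g' t)); norm_lra.
Qed.

Lemma short_path_geodesic c L : 0 <= L -> short_path c L ->
  mdist (c 0) (c L) = L -> geodesic c L.
Proof.
move=> L0 h cL s t hs ht; apply/eqP; rewrite eq_le h//=.
have := short_path_excess (K := 0) L0 h _ hs ht.
by rewrite cL !addr0; apply.
Qed.

(** The form in which the hypothesis on [space_pi] is used: [c] is a detour around the open ball of
    radius [r] centred at the midpoint [g r]. *)
Definition detour_bound N r1 := forall g r c L, r1 <= r -> 0 <= L ->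
  geodesic g (2 * r) -> short_path c L -> c 0 = g 0 -> c L = g (2 * r) ->
  (forall t, 0 <= t <= L -> r <= mdist (g r) (c t)) -> N * r <= L.

End Paths.

Arguments detour_bound {R} X N r1.

(** * Detours and stability of quasi-geodesics in a geodesic space *)

Section Geodesic.
Context {R : realType} {X : metricType R}.
Implicit Types (g c : R -> X) (l L s t : R) (a b p : X) (S : set X).

Context (geodesic_ex : forall a b, exists g : R -> X,
  [/\ geodesic g (mdist a b), g 0 = a & g (mdist a b) = b]).

Lemma joined_geodesic S a b :
  (forall y, mdist a y + mdist y b = mdist a b -> S y) -> joined S a b (mdist a b).
Proof.
move=> hS; have [g [h g0 gl]] := geodesic_ex a b.
have ab0 := mdist_ge0 a b.
exists g; split => //; first exact: geodesic_short.
move=> t ht; apply: hS.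
have -> : mdist a (g t) = t by rewrite -{1}g0 h; [norm_lra|lra|lra].
have -> : mdist (g t) b = mdist a b - t by rewrite -{1}gl h; [norm_lra|lra|lra].
by ring.
Qed.

(** Half of a detour around [g 0]: follow [g] up to time [2 * D], then jump to [c] along a geodesic
    of length at most [D], which stays [D]-far from [g 0]. If [g] is shorter than that, follow it to
    its end, which lies on [c]. *)
Lemma joined_to_path g m c L D D' s0 : 0 <= D' <= D -> 0 <= m -> geodesic g m ->
  0 <= s0 <= L -> g m = c s0 ->
  (forall s, 0 <= s <= L -> D' <= mdist (g 0) (c s)) ->
  (forall t, 0 <= t <= m -> exists2 s, 0 <= s <= L & mdist (g t) (c s) <= D) ->
  exists s1 L1, [/\ 0 <= s1 <= L, L1 <= 3 * D - D', mdist (g 0) (c s1) <= 3 * D &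
    joined [set y | D' <= mdist (g 0) y] (g D') (c s1) L1].
Proof.
move=> hD m0 h hs0 gm far close.
have h0 t : 0 <= t <= m -> mdist (g 0) (g t) = t.
  by move=> ht; rewrite h; [norm_lra|lra|lra].
have D'm : D' <= m by rewrite -(h0 m) ?gm; [exact: far|lra].
have [m2D|/ltW m2D] := leP (2 * D) m; last first.
  exists s0, `|D' - m|; split => //; first by norm_lra.
    by rewrite -gm h0; lra.
  rewrite -gm; apply: joined_sub (geodesic_short h) _ _ _; [lra|lra|].
  by move=> w /= [] hw; rewrite h0; lra.
have [s1 hs1 gs1] := close (2 * D) ltac:(lra).
have := metric_triangle (g 0) (g (2 * D)) (c s1); rewrite h0; last by lra.
move=> tri; exists s1, (`|D' - 2 * D| + mdist (g (2 * D)) (c s1)); split => //.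
- by norm_lra.
- by lra.
apply: joined_cat.
  apply: joined_sub (geodesic_short h) _ _ _; [lra|lra|].
  by move=> w /= [] hw; rewrite h0; lra.
apply: joined_geodesic => y /= e.
have := metric_triangle (g 0) y (g (2 * D)); rewrite h0; last by lra.
have := mdist_ge0 y (c s1).
by rewrite (metric_sym y (g _)); lra.
Qed.

(** Rather than choosing a point of [g] farthest from [c], lower the closeness constant by unit
    steps: above [D0], a point that is not [(D - 1)]-close to [c] would be the centre of a ball with
    too short a detour. *)
Lemma near_quasigeodesic N r1 lam K : detour_bound X N r1 -> 4 + 6 * lam < N -> 0 <= lam ->
  0 <= K -> exists2 D, 0 <= D & forall g l c L, 0 <= l -> 0 <= L ->
    geodesic g l -> short_path c L -> c 0 = g 0 -> c L = g l ->
    (forall s t, 0 <= s <= L -> 0 <= t <= L ->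
      `|s - t| <= lam * mdist (c s) (c t) + K) ->
    forall t, 0 <= t <= l -> exists2 s, 0 <= s <= L & mdist (g t) (c s) <= D.
Proof.
move=> HN hN lam0 K0.
(* For [D > D0], the radius [D - 1] exceeds [r1], and [N * (D - 1) <= (4 + 6 * lam) * D + K + 2]
   fails. *)
pose D0 := `|r1| + 1 + (2 + K + N) / (N - 4 - 6 * lam).
have N4 : 0 < N - 4 - 6 * lam by lra.
have q0 : 0 <= (2 + K + N) / (N - 4 - 6 * lam) by apply: divr_ge0; lra.
have D01 : 1 <= D0 by rewrite /D0; norm_lra.
have D0r : r1 + 1 <= D0 by rewrite /D0; norm_lra.
have D0q : 2 + K + N <= D0 * (N - 4 - 6 * lam).
  by rewrite -ler_pdivrMr// /D0; norm_lra.
clearbody D0; clear q0.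
exists D0 => [|g l c L l0 L0 hg hc c0 cL qg]; first by lra.
pose P D := forall t, 0 <= t <= l -> exists2 s, 0 <= s <= L & mdist (g t) (c s) <= D.
(* The detour built below has length at most (4 + 6 lam) D + K + 2. *)
have step D : D0 < D -> P D -> P (D - 1).
  move=> D0D PD t0 ht0; apply: contrapT => nclose.
  have hD' : 0 <= D - 1 <= D by lra.
  have far s : 0 <= s <= L -> D - 1 <= mdist (g t0) (c s).
    move=> hs; have [//|/ltW] := leP (D - 1) (mdist (g t0) (c s)).
    by move=> near; exfalso; apply: nclose; exists s.
  have D't0 : D - 1 <= t0.
    have : D - 1 <= `|t0 - 0| by rewrite -hg -?c0 ?far; lra.
    by norm_lra.
  have D'l : D - 1 <= l - t0.
    have : D - 1 <= `|t0 - l| by rewrite -hg -?cL ?far; lra.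
    by norm_lra.
  have hg1 : geodesic (fun t => g (t0 - t)) t0 by apply: geodesic_rev hg; lra.
  have hg2 : geodesic (fun t => g (t0 + t)) (l - t0) by apply: geodesic_sub hg; lra.
  have t00 : 0 <= t0 by lra.
  have lt0 : 0 <= l - t0 by lra.
  have [|||t ht|s1 [L1 [hs1 hL1 d1 J1]]] :=
    joined_to_path (c := c) (L := L) (s0 := 0) hD' t00 hg1.
  - by lra.
  - by rewrite subrr c0.
  - by rewrite subr0.
  - by apply: PD; lra.
  have [|||t ht|s2 [L2 [hs2 hL2 d2 J2]]] :=
    joined_to_path (c := c) (L := L) (s0 := L) hD' lt0 hg2.
  - by lra.
  - by rewrite addrC subrK cL.
  - by rewrite addr0.
  - by apply: PD; lra.
  rewrite /= subr0 in d1 J1; rewrite /= addr0 in d2 J2.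
  have J3 : joined [set y | D - 1 <= mdist (g t0) y] (c s1) (c s2) `|s1 - s2|.
    by apply: (joined_sub hc) => // w hw; apply: far; lra.
  have d12 : mdist (c s1) (c s2) <= 6 * D.
    by apply: le_trans (metric_triangle _ (g t0) _) _; rewrite metric_sym; lra.
  have := qg s1 s2 hs1 hs2 => hs12.
  have lD : lam * mdist (c s1) (c s2) <= lam * (6 * D) by rewrite ler_wpM2l.
  have [c' [L'0 hc' c'0 c'L c'S]] :=
      joined_cat (joined_cat J1 J3) (joined_sym J2).
  have := HN (fun t => g (t0 - (D - 1) + t)) (D - 1) c' _ _ L'0.
  rewrite (_ : t0 - (D - 1) + (D - 1) = t0); last by ring.
  rewrite c'0 c'L => HN'; have {}HN' := HN' _ _ hc' _ _ c'S.
  have : N * (D - 1) <= L1 + `|s1 - s2| + L2.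
    apply: HN'; first by lra.
    - rewrite (_ : 2 * (D - 1) = (t0 + (D - 1)) - (t0 - (D - 1))); last by ring.
      by apply: geodesic_sub hg; lra.
    - by rewrite addr0.
    - by congr g; ring.
  have : (2 + K + N) < D * (N - 4 - 6 * lam).
    by apply: le_lt_trans D0q _; rewrite ltr_pM2r.
  nra.
have PD0 n : P (D0 + n%:R) -> P D0.
  elim: n => [|n ih]; first by rewrite addr0.
  rewrite -natr1 addrA => /step h; apply: ih.
  by move: h; rewrite addrK; apply; rewrite ltr_pwDr// lerDl.
(* The descent can start here because all of [g] is within [l] of [c 0]. *)
apply: (PD0 (Num.trunc l).+1) => t ht.
exists 0; first by lra.
rewrite c0 hg; [|lra|lra].
by have := truncnS_gt l; norm_lra.
Qed.

(** * Thinness of almost geodesic bigons *)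

Definition tracking D := forall g l c L, 0 <= l -> 0 <= L -> geodesic g l ->
  short_path c L -> c 0 = g 0 -> c L = g l -> L <= l + 1 ->
  forall t, 0 <= t <= l -> mdist (g t) (c t) <= D.

(** Here [c] is a (1, 1)-quasi-geodesic, and 10 = 4 + 6. Both parameters measure the distance to the
    origin, for [c] up to 1, so those of [D]-close points differ by at most [D + 1]. *)
Lemma tracking_ex N r1 : detour_bound X N r1 -> 10 < N ->
  exists2 D, 0 <= D & tracking D.
Proof.
move=> HN N10.
have [||| D D0 HD] := @near_quasigeodesic N r1 1 1 HN; [lra..|].
exists (2 * D + 1) => [|g l c L l0 L0 hg hc c0 cL Ll t ht]; first by lra.
have dl : mdist (c 0) (c L) = l by rewrite c0 cL hg; [norm_lra|lra|lra].
have lL : l <= L by rewrite -dl; apply: le_trans (hc _ _ _ _) _; [lra|lra|norm_lra].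
have exc : L <= mdist (c 0) (c L) + 1 by rewrite dl.
have [|s hs gs] := HD g l c L l0 L0 hg hc c0 cL _ t ht.
  by move=> s s'; rewrite mul1r; apply: short_path_excess.
have : mdist (c 0) (c s) <= `|0 - s| by apply: hc; lra.
have z0 : 0 <= (0 : R) <= L by rewrite lexx L0.
have := short_path_excess L0 hc exc z0 hs.
have : mdist (g 0) (g t) = t by rewrite hg; [norm_lra|lra|lra].
have : mdist (c s) (c t) <= `|s - t| by apply: hc; lra.
have := metric_triangle (g t) (c s) (c t).
have := metric_triangle (g 0) (g t) (c s).
have := metric_triangle (g 0) (c s) (g t).
rewrite c0 (metric_sym (c s) (g t)); norm_lra.
Qed.

Definition fellow K K' := forall g l g' l', 0 <= l -> 0 <= l' ->
  geodesic g l -> geodesic g' l' -> g 0 = g' 0 -> mdist (g l) (g' l') <= K ->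
  forall t, 0 <= t <= l -> t <= l' -> mdist (g t) (g' t) <= K'.

(** Extended by a geodesic to the end of [g], [g'] becomes a (1, 2K)-quasi-geodesic, hence passes
    near [g]. A close point on the extension is replaced by the end of [g'], at a cost of [K];
    [geodesic_radial] then synchronizes the parameters. *)
Lemma fellow_ex N r1 : detour_bound X N r1 -> 10 < N ->
  forall K, 0 <= K -> exists2 K', 0 <= K' & fellow K K'.
Proof.
move=> HN N10 K K0.
have [||| D D0 HD] := @near_quasigeodesic N r1 1 (2 * K) HN; [lra..|].
exists (2 * (D + K)) => [|g l g' l' l0 l'0 hg hg' gg' ends t ht tl']; first by lra.
have [h [hh h0 h1]] := geodesic_ex (g' l') (g l).
move: hh h0 h1; set e := mdist (g' l') (g l) => hh h0 h1.
have e0 : 0 <= e by exact: mdist_ge0.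
have eK : e <= K by rewrite /e metric_sym.
have esym h0' := esym h0'.
pose c := path_cat g' l' h.
have c0 : c 0 = g 0 by rewrite /c path_catl.
have cL : c (l' + e) = g l by rewrite /c path_catr; [rewrite addrAC subrr add0r| |lra].
have hc : short_path c (l' + e).
  by apply: short_path_cat; [exact: geodesic_short|exact: geodesic_short|].
have L0 : 0 <= l' + e by lra.
have dl : mdist (c 0) (c (l' + e)) = l by rewrite c0 cL hg; [norm_lra|lra|lra].
have ll' : `|l - l'| <= e.
  by rewrite /e metric_sym; apply: (geodesic_radial hg hg') => //; lra.
have exc : l' + e <= mdist (c 0) (c (l' + e)) + 2 * K by rewrite dl; move: ll'; norm_lra.
have [|s hs gs] := HD g l c (l' + e) l0 L0 hg hc c0 cL _ t ht.
  by move=> s s'; rewrite mul1r; apply: short_path_excess.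
have [u hu gu] : exists2 u, 0 <= u <= l' & mdist (g t) (g' u) <= D + K.
  move: gs; rewrite /c; have [sl'|/ltW sl'] := leP s l'.
    by rewrite path_catl// => ?; exists s; lra.
  rewrite path_catr// => ?; exists l'; first by lra.
  have := metric_triangle (g t) (h (s - l')) (g' l').
  rewrite -[in X in _ <= _ + X]h0 hh; [|lra|lra].
  by norm_lra.
have := metric_triangle (g t) (g' u) (g' t).
have := geodesic_radial hg hg' gg' ht hu.
rewrite (hg' u t); [|lra|lra].
by norm_lra.
Qed.

(* If both the detour crossing from [g] to [g'] at once and the one crossing at
   the last moment are almost geodesic, they track the same geodesic. *)
Lemma early_late_crossing D g g' i w : 0 <= D -> tracking D -> 0 <= i -> 0 <= w ->
  geodesic g (i + 3 * w) -> geodesic g' (i + 3 * w) -> g 0 = g' 0 ->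
  mdist (g i) (g' (i + w)) <= 2 * w ->
  mdist (g i) (g' (i + w)) + 2 * w <= mdist (g i) (g' (i + 3 * w)) + 1 ->
  2 * w + mdist (g (i + 2 * w)) (g' (i + 3 * w)) <=
    mdist (g i) (g' (i + 3 * w)) + 1 ->
  mdist (g (i + 2 * w)) (g' (i + 2 * w)) <= 4 * D.
Proof.
move=> D0 HD i0 w0 hg hg' gg' e1w early late.
have [k [hk k0 k1]] := geodesic_ex (g i) (g' (i + 3 * w)).
have [h1 [hh1 h10 h11]] := geodesic_ex (g i) (g' (i + w)).
have [h2 [hh2 h20 h21]] := geodesic_ex (g (i + 2 * w)) (g' (i + 3 * w)).
move: hk k1 hh1 h11 hh2 h21 e1w early late.
have : `|i - (i + 3 * w)| <= mdist (g i) (g' (i + 3 * w)).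
  by apply: (geodesic_radial hg hg') => //; lra.
have := mdist_ge0 (g i) (g' (i + w)).
have := mdist_ge0 (g (i + 2 * w)) (g' (i + 3 * w)).
set q := mdist (g i) (g' (i + 3 * w)).
set e1 := mdist (g i) (g' (i + w)).
set e2 := mdist (g (i + 2 * w)) (g' (i + 3 * w)).
move=> e20 e10 qw hk k1 hh1 h11 hh2 h21 e1w early late.
have q2w : 0 <= 2 * w <= q by move: qw; norm_lra.
pose g1 t := g' (i + w + t).
pose g2 t := g (i + t).
have s1 : short_path (path_cat h1 e1 g1) (e1 + 2 * w).
  apply: short_path_cat; first exact: geodesic_short.
    rewrite (_ : 2 * w = i + 3 * w - (i + w)); last by ring.
    by apply: short_path_sub (geodesic_short hg'); lra.
  by rewrite h11 /g1 addr0.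
have s2 : short_path (path_cat g2 (2 * w) h2) (2 * w + e2).
  apply: short_path_cat; last by rewrite h20.
    rewrite (_ : 2 * w = i + 2 * w - i); last by ring.
    by apply: short_path_sub (geodesic_short hg); lra.
  exact: geodesic_short.
(* The early crossing reaches [g' (i + w)] at time [e1 <= 2 * w], so this is its position at time
   [2 * w]. *)
have t1 : mdist (k (2 * w)) (g' (i + 3 * w - e1)) <= D.
  have := HD k q (path_cat h1 e1 g1) (e1 + 2 * w).
  have -> : g' (i + 3 * w - e1) = path_cat h1 e1 g1 (2 * w).
    by rewrite path_catr ?h11 /g1 ?addr0//; congr g'; ring.
  apply=> //; [lra..| | ].
    by rewrite path_catl// h10.
  rewrite path_catr; [|by rewrite h11 /g1 addr0|lra].
  by rewrite k1 /g1; congr g'; ring.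
have t2 : mdist (k (2 * w)) (g (i + 2 * w)) <= D.
  have := HD k q (path_cat g2 (2 * w) h2) (2 * w + e2).
  have -> : g (i + 2 * w) = path_cat g2 (2 * w) h2 (2 * w) by rewrite path_catl.
  apply=> //; [lra..| | ].
    by rewrite path_catl ?k0 /g2 ?addr0//; lra.
  by rewrite path_catr; [rewrite addrAC subrr add0r h21|rewrite h20|lra].
(* The two positions are [2 * D]-close, so their radial parameters differ by at most [2 * D]; moving
   along [g'] to [g' (i + 2 * w)] costs that much again. *)
have := metric_triangle (g (i + 2 * w)) (k (2 * w)) (g' (i + 3 * w - e1)).
have := metric_triangle (g (i + 2 * w)) (g' (i + 3 * w - e1)) (g' (i + 2 * w)).
have : `|i + 2 * w - (i + 3 * w - e1)| <=
    mdist (g (i + 2 * w)) (g' (i + 3 * w - e1)).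
  apply: (geodesic_radial hg hg') => //; first by lra.
  have : `|i - (i + w)| <= e1 by apply: (geodesic_radial hg hg') => //; lra.
  by norm_lra.
rewrite (metric_sym (g (i + 2 * w)) (k _)) hg'; [|norm_lra|norm_lra].
by norm_lra.
Qed.

(* The cost [mdist (g i) (g' j) - (j - i)] of crossing from [g] to [g'] during
   the time interval [i, j] lies in [0, K] and increases when the interval
   shrinks: among nested thirds, it eventually stops increasing. *)
Lemma crossing_ex D K g g' rho w n i : 0 <= D -> tracking D -> 0 <= K <= w ->
  geodesic g rho -> geodesic g' rho -> g 0 = g' 0 ->
  (forall t, 0 <= t <= rho -> mdist (g t) (g' t) <= K) ->
  0 <= i -> i + 3 ^+ n * w <= rho ->
  K + 1 - n%:R <= mdist (g i) (g' (i + 3 ^+ n * w)) - 3 ^+ n * w ->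
  exists2 t, i <= t <= i + 3 ^+ n * w & mdist (g t) (g' t) <= 4 * D.
Proof.
move=> D0 HD hK hg hg' gg' close.
elim: n i => [i i0|n ih i i0].
  rewrite expr0 mul1r subr0 => irho.
  have := metric_triangle (g i) (g' i) (g' (i + w)).
  have := close i; rewrite hg'; [|lra|lra].
  have hi : 0 <= i <= rho by lra.
  by move=> /(_ hi); norm_lra.
have : 1 <= 3 ^+ n :> R by apply: exprn_ege1; rewrite ler1n.
rewrite exprS -mulrA; set W := 3 ^+ n * w => n3 irho.
have wW : w <= W by rewrite /W ler_peMl//; lra.
rewrite -natr1 => cost.
(* If the first or the last third reaches the next threshold, recurse into it. Otherwise crossing in
   either costs at most 1 more than crossing over the whole interval, as [early_late_crossing]
   requires. *)
have [c1|c1] := leP (K + 1 - n%:R) (mdist (g i) (g' (i + W)) - W).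
  by have [|t ht ?] := ih i i0 _ c1; [rewrite -/W; lra|exists t; rewrite -/W in ht; lra].
have e3 : i + 3 * W = i + 2 * W + W by ring.
have [c2|c2] := leP (K + 1 - n%:R)
    (mdist (g (i + 2 * W)) (g' (i + 3 * W)) - W).
  have [|||t ht ?] := ih (i + 2 * W).
  - by lra.
  - by rewrite -/W; lra.
  - by rewrite -/W -e3.
  - by exists t; rewrite -/W in ht; lra.
exists (i + 2 * W); first by lra.
apply: early_late_crossing => //; [lra| | | | |].
- by apply: geodesic_le hg.
- by apply: geodesic_le hg'.
- have := metric_triangle (g i) (g' i) (g' (i + W)).
  have := close i; rewrite hg'; [|lra|lra].
  have hi : 0 <= i <= rho by lra.
  by move=> /(_ hi); norm_lra.
- lra.
- lra.
Qed.

(** * Divergence of geodesics and superlinear detours *)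

Definition converging M K r0 := forall g l g' l', 0 <= l -> 0 <= l' ->
  geodesic g l -> geodesic g' l' -> g 0 = g' 0 -> mdist (g l) (g' l') <= K ->
  forall t, 0 <= t -> t + r0 <= l -> t + r0 <= l' -> mdist (g t) (g' t) <= M.

(** [M] is chosen before [K]: only the delay [r0] depends on [K]. Within that delay after [t],
    [crossing_ex] finds a time at which the geodesics are [4 * D]-close, and [fellow] carries this
    back to [t]. *)
Lemma converging_ex N r1 : detour_bound X N r1 -> 10 < N ->
  exists2 M, 0 <= M & forall K, 0 <= K -> exists2 r0, 0 <= r0 & converging M K r0.
Proof.
move=> HN N10; have [D D0 HD] := tracking_ex HN N10.
have [|M M0 HM] := fellow_ex HN N10 (K := 4 * D); first by lra.
exists M => // K K0; have [K' K'0 HK'] := fellow_ex HN N10 K0.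
(* Now [K' + 1 - n%:R] is negative, so any crossing cost meets the lower bound of [crossing_ex]. *)
pose n := (Num.trunc (K' + 1)).+1.
have n3 : 1 <= 3 ^+ n :> R by apply: exprn_ege1; rewrite ler1n.
exists (3 ^+ n * K'); first by apply: mulr_ge0; lra.
move=> g l g' l' l0 l'0 hg hg' gg' ends t t0 tl tl'.
have w0 : 0 <= 3 ^+ n * K' by apply: mulr_ge0; lra.
have hg1 := geodesic_le tl hg; have hg1' := geodesic_le tl' hg'.
have [|||||s hs gs] := crossing_ex (n := n) (i := t) D0 HD _ hg1 hg1' gg' (K := K') (w := K').
- by lra.
- by move=> s hs; apply: (HK' g l g' l') => //; lra.
- by [].
- by [].
- have := truncnS_gt (K' + 1); rewrite -/n.
  have : `|t - (t + 3 ^+ n * K')| <= mdist (g t) (g' (t + 3 ^+ n * K')).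
    by apply: (geodesic_radial hg hg') => //; lra.
  by norm_lra.
have hg2 : geodesic g s by apply: geodesic_le hg; lra.
have hg2' : geodesic g' s by apply: geodesic_le hg'; lra.
by apply: (HM g s g' s) => //; lra.
Qed.

(* Bisect the path: by induction the geodesic to its midpoint is M-close to the
   two other ones, which are then 2M-close, hence M-close a time r0 earlier. *)
Lemma divergence M K r0 p n : 1 <= K -> 2 * M <= K -> 0 <= r0 ->
  converging M K r0 ->
  forall c L rho g g' t, 0 <= L <= 2 ^+ n -> short_path c L ->
  (forall s, 0 <= s <= L -> rho <= mdist p (c s)) ->
  geodesic g (mdist p (c 0)) -> g 0 = p -> g (mdist p (c 0)) = c 0 ->
  geodesic g' (mdist p (c L)) -> g' 0 = p -> g' (mdist p (c L)) = c L ->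
  0 <= t -> t + n.+1%:R * r0 <= rho -> mdist (g t) (g' t) <= M.
Proof.
move=> K1 MK r00 Hc; elim: n => [|n ih] c L rho g g' t hL hc far hg g0 gl hg' g'0 gl' t0 trho.
  have far0 : rho <= mdist p (c 0) by apply: far; lra.
  have farL : rho <= mdist p (c L) by apply: far; lra.
  rewrite mul1r in trho; rewrite expr0 in hL.
  have gg' : g 0 = g' 0 by rewrite g0 g'0.
  have ends : mdist (g (mdist p (c 0))) (g' (mdist p (c L))) <= K.
    by rewrite gl gl'; apply: le_trans (hc _ _ _ _) _; [lra|lra|norm_lra].
  by apply: (Hc _ _ _ _ _ _ hg hg' gg' ends); rewrite ?mdist_ge0//; lra.
have [k [hk k0 kl]] := geodesic_ex p (c (L / 2)).
rewrite exprS in hL; rewrite -natr1 mulrDl mul1r in trho.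
have n0 : 0 <= n.+1%:R * r0 by apply: mulr_ge0.
have far0 : rho <= mdist p (c 0) by apply: far; lra.
have farL : rho <= mdist p (c L) by apply: far; lra.
have L2 : L / 2 = L - L / 2 by field.
have d1 : mdist (g (t + r0)) (k (t + r0)) <= M.
  apply: (ih c (L / 2) rho) => //; try lra.
    by move=> s s' hs hs'; apply: hc; lra.
  by move=> s hs; apply: far; lra.
have d2 : mdist (k (t + r0)) (g' (t + r0)) <= M.
  have e0 : L / 2 + 0 = L / 2 by rewrite addr0.
  have eL : L / 2 + L / 2 = L by field.
  apply: (ih (fun s => c (L / 2 + s)) (L / 2) rho) => //; rewrite ?e0 ?eL//; try lra.
    by rewrite [X in short_path _ X]L2; apply: short_path_sub hc; lra.
  by move=> s hs; apply: far; lra.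
have tr : t + r0 <= mdist p (c 0) by lra.
have tr' : t + r0 <= mdist p (c L) by lra.
have gg' : g 0 = g' 0 by rewrite g0 g'0.
have ends : mdist (g (t + r0)) (g' (t + r0)) <= K.
  by apply: le_trans (metric_triangle _ (k (t + r0)) _) _; lra.
by apply: (Hc _ _ _ _ _ _ (geodesic_le tr hg) (geodesic_le tr' hg') gg' ends); lra.
Qed.

(** From the centre, the two halves of the geodesic lead to the ends of the detour. If it were
    shorter than [N' * r <= 2 ^+ n], [divergence] would keep them [M]-close at a time [t > M], when
    they are [2 * t] apart. *)
Lemma detour_bound_all N r1 : detour_bound X N r1 -> 10 < N ->
  forall N', 0 <= N' -> exists r1', detour_bound X N' r1'.
Proof.
move=> HN N10 N' N'0.
have [M M0 conv] := converging_ex HN N10.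
have [|r0 r00 Hr0] := conv (2 * M + 1); first by lra.
have [||| r1' Hr1'] := @exp_growth R (r0 + 1) (r0 + M + 1) N'; [lra..|].
exists r1' => g r c L r1r L0 hg hc c0 cL far.
have [n Nn nr] := Hr1' r r1r.
have [//|LN] := leP (N' * r) L; exfalso.
have n0 : 0 <= n%:R * r0 by apply: mulr_ge0.
have nR : 0 <= n%:R :> R by [].
have r_gt0 : 0 < r by move: nr; rewrite mulrDr; lra.
pose t := r - n.+1%:R * r0.
have tM : M < t by move: nr; rewrite /t -natr1 mulrDr mulrDl; lra.
have tr : t <= r by rewrite /t gerBl mulr_ge0.
have d0 : mdist (g r) (c 0) = r by rewrite c0 hg; [norm_lra|lra|lra].
have dL : mdist (g r) (c L) = r by rewrite cL hg; [norm_lra|lra|lra].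
have hg1 : geodesic (fun s => g (r - s)) r by apply: geodesic_rev hg; lra.
have hg2 : geodesic (fun s => g (r + s)) r.
  have {2}-> : r = 2 * r - r by ring.
  by apply: geodesic_sub hg; lra.
have : mdist (g (r - t)) (g (r + t)) <= M.
  apply: (@divergence M (2 * M + 1) r0 (g r) n _ _ _ _ c L r
    (fun s => g (r - s)) (fun s => g (r + s)) t) => //; rewrite ?d0 ?dL ?subr0 ?addr0 ?subrr//.
  - lra.
  - lra.
  - lra.
  - by rewrite cL; congr g; ring.
  - lra.
  - by rewrite /t subrK.
rewrite hg; [norm_lra|lra|lra].
Qed.

(** * Slim triangles *)

Lemma approx_connected (P : R -> Prop) l : 0 <= l -> P 0 ->
  P l \/ exists t t', [/\ 0 <= t <= l, 0 <= t' <= l, `|t - t'| <= 1, P t & ~ P t'].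
Proof.
move=> l0 P0; apply: contrapT => /not_orP[nPl nex].
(* Unit steps along the interval, the last one cut at [l], replace connectedness. *)
have Pn n : P (Num.min n%:R l).
  elim: n => [|n ih]; first by rewrite (min_idPl l0).
  apply: contrapT => nP; apply: nex; exists (Num.min n%:R l), (Num.min n.+1%:R l).
  have n0 : 0 <= n%:R :> R by [].
  split=> //; rewrite -?natr1 !minElt;
    case: ltP => ?; try case: ltP => ?; norm_lra.
apply: nPl; have := Pn (Num.trunc l).+1.
by rewrite (min_idPr _)// ltW// truncnS_gt.
Qed.

(* A geodesic followed by a shortest path from one of its points is a
   (3, 2)-quasi-geodesic. *)
Lemma slim_half N r1 : detour_bound X N r1 -> 22 < N ->
  exists2 D, 0 <= D & forall g tau k e h l, 0 <= tau -> 0 <= e -> 0 <= l ->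
    geodesic g tau -> geodesic k e -> geodesic h l ->
    g tau = k 0 -> k e = h l -> h 0 = g 0 ->
    (forall t, 0 <= t <= tau -> e <= mdist (g t) (k e) + 1) ->
    forall t, 0 <= t <= tau -> exists2 s, 0 <= s <= l & mdist (g t) (h s) <= D.
Proof.
move=> HN N22.
have [|||D D0 HD] := @near_quasigeodesic N r1 3 2 HN; [lra..|].
exists (7 * D + 5) => [|g tau k e h l tau0 e0 l0 hg hk hh gk kh hg0 foot t0 ht0].
  by lra.
pose b := path_cat g tau k.
have L0 : 0 <= tau + e by lra.
have b0 : b 0 = h 0 by rewrite /b path_catl.
have bL : b (tau + e) = h l by rewrite /b path_catr; [rewrite addrAC subrr add0r| |lra].
have hb : short_path b (tau + e).
  by apply: short_path_cat; [exact: geodesic_short|exact: geodesic_short|].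
have qg : forall s t, 0 <= s -> s <= t -> t <= tau + e -> t - s <= 3 * mdist (b s) (b t) + 2.
  move=> s t s0 st tL; have := mdist_ge0 (b s) (b t); rewrite /b.
  have [ttau|/ltW ttau] := leP t tau.
    by rewrite !path_catl ?hg; [norm_lra|lra..].
  have [stau|/ltW stau] := leP s tau; last first.
    by rewrite !path_catr ?hk//; [norm_lra|lra..].
  rewrite path_catl// path_catr//.
  (* With [d] the distance of the two points, [foot] gives [t - tau <= d + 1], hence
     [tau - s <= 2 * d + 1]; the sum is [3 * d + 2]. *)
  have := foot s; have : mdist (g s) (g tau) = tau - s.
    by rewrite hg; [norm_lra|lra|lra].
  have := metric_triangle (g s) (k (t - tau)) (k e).
  have := metric_triangle (g s) (k (t - tau)) (g tau).
  have hs : 0 <= s <= tau by lra.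
  rewrite gk !hk; [|lra..].
  by move=> + + + /(_ hs); norm_lra.
have {}qg s t : 0 <= s <= tau + e -> 0 <= t <= tau + e ->
    `|s - t| <= 3 * mdist (b s) (b t) + 2.
  move=> hs ht; have [st|/ltW ts] := leP s t.
    by have : t - s <= 3 * mdist (b s) (b t) + 2 by [apply: qg; lra]; norm_lra.
  rewrite (metric_sym (b s)).
  by have : s - t <= 3 * mdist (b t) (b s) + 2 by [apply: qg; lra]; norm_lra.
have {}HD := HD h l b (tau + e) l0 L0 hh hb b0 bL qg.
have -> : g t0 = b t0 by rewrite /b path_catl//; lra.
(* [HD] places [h] near [b]; the converse is wanted. Where [h] passes from points close to [b]
   before [t0] to points close to [b] after it, two points of [b] on either side of [t0] are
   [(2 * D + 1)]-close, so their parameters differ by at most [6 * D + 5]. *)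
pose P t := exists2 s, 0 <= s <= t0 & mdist (h t) (b s) <= D.
have P0 : P 0 by exists 0; [lra|rewrite b0 mdistxx].
suff [t [s1 [ht hs1 ts1 s1t0]]] : exists t s1, [/\ 0 <= t <= l, 0 <= s1 <= t0,
    mdist (h t) (b s1) <= D & t0 - s1 <= 6 * D + 5].
  exists t => //.
  have := metric_triangle (b t0) (b s1) (h t).
  have : mdist (b t0) (b s1) <= `|t0 - s1| by apply: hb; lra.
  by rewrite (metric_sym (b s1)); norm_lra.
have [[s1 hs1 ls1]|[t [t' [ht ht' tt' [s1 hs1 ts1] nP]]]] := approx_connected l0 P0.
  exists l, s1; split => //; first by lra.
  rewrite -bL in ls1; have hs1' : 0 <= s1 <= tau + e by lra.
  have hL' : 0 <= tau + e <= tau + e by lra.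
  have := qg _ _ hs1' hL'.
  by rewrite metric_sym; norm_lra.
have [s2 hs2 ts2] := HD t' ht'.
exists t, s1; split => //.
have s2t0 : t0 <= s2.
  have [//|/ltW s2t0] := leP t0 s2; exfalso.
  by apply: nP; exists s2 => //; lra.
have hs1' : 0 <= s1 <= tau + e by lra.
have := qg _ _ hs1' hs2.
have := metric_triangle (b s1) (h t) (b s2).
have := metric_triangle (h t) (h t') (b s2).
by rewrite hh// (metric_sym (b s1) (h t)); move: tt'; norm_lra.
Qed.

(** For an arbitrary [f] the infimum may not be attained, hence the error 1. *)
Lemma approx_foot (x : X) (f : R -> X) l : 0 <= l -> exists2 tau, 0 <= tau <= l &
  forall t, 0 <= t <= l -> mdist (f tau) x <= mdist (f t) x + 1.
Proof.
move=> l0; pose E := [set mdist (f t) x | t in [set t | 0 <= t <= l]].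
have E0 : has_inf E.
  split; first by exists (mdist (f 0) x), 0 => //=; rewrite lexx.
  by exists 0 => _ [t _ <-]; exact: mdist_ge0.
have [_ [tau htau <-] lt1] := inf_adherent ltr01 E0.
exists tau => // t ht; apply: le_trans (ltW lt1) _; rewrite lerD2r.
by apply: ge_inf; [exact: E0.2|exists t].
Qed.

(** An almost nearest point to the opposite vertex cuts the first side in two; [slim_half] compares
    the part before it with the third side and the part after it with the second, both parts run
    towards the cut. *)
Lemma detour_bound_hyperbolic N r1 : detour_bound X N r1 -> 10 < N ->
  gromov_hyperbolic X.
Proof.
move=> HN N10.
(* [slim_half] needs more than 22 = 4 + 6 * 3. *)
have [|r2 Hr2] := detour_bound_all HN N10 (N' := 23); first by lra.
have [|D D0 HD] := slim_half Hr2; first by lra.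
exists D => // I1 I2 I3.
case: I1 I2 I3 => [l1 f1 l10 hf1] [l2 f2 l20 hf2] [l3 f3 l30 hf3].
rewrite /gi_target /gi_source /gi_set /= => e12 e23 e31 _ [t0 ht0 <-].
have {}hf1 : geodesic f1 l1 by move=> s t hs ht; apply: hf1; rewrite in_itv.
have {}hf2 : geodesic f2 l2 by move=> s t hs ht; apply: hf2; rewrite in_itv.
have {}hf3 : geodesic f3 l3 by move=> s t hs ht; apply: hf3; rewrite in_itv.
rewrite in_itv/= in ht0.
have [tau htau foot] := approx_foot (f2 l2) f1 l10.
have [k [hk k0 kl]] := geodesic_ex (f1 tau) (f2 l2).
have e0 := mdist_ge0 (f1 tau) (f2 l2).
move: (mdist (f1 tau) (f2 l2)) hk kl foot e0 => e hk kl foot e0.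
have [t0tau|/ltW taut0] := leP t0 tau.
  have tau0 : 0 <= tau by lra.
  have hg : geodesic f1 tau by apply: geodesic_le hf1; lra.
  have hh : geodesic (fun t => f3 (l3 - t)) l3 by apply: geodesic_rev hf3.
  have [|||||s hs ?] := HD _ _ _ _ _ _ tau0 e0 l30 hg hk hh _ _ _ _ t0.
  - by rewrite k0.
  - by rewrite kl subrr.
  - by rewrite subr0.
  - by move=> t ht; rewrite kl; apply: foot; lra.
  - by lra.
  by exists (f3 (l3 - s)) => //; right; exists (l3 - s) => //; rewrite in_itv/=; lra.
have tau0 : 0 <= l1 - tau by lra.
have hg : geodesic (fun t => f1 (l1 - t)) (l1 - tau).
  by apply: (geodesic_le (l := l1)); [lra|apply: geodesic_rev hf1].
have [|||||s hs] := HD _ _ _ _ _ _ tau0 e0 l20 hg hk hf2 _ _ _ _ (l1 - t0).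
- by rewrite k0; congr f1; ring.
- by rewrite kl.
- by rewrite subr0.
- by move=> t ht; rewrite kl; apply: foot; lra.
- by lra.
rewrite subKr => ?.
by exists (f2 s) => //; left; exists s => //; rewrite in_itv.
Qed.

End Geodesic.

(** * From [space_pi] to detour bounds *)

Section Detours.
Context {R : realType} {X : metricType R}.
Implicit Types (g c : R -> X) (l L s t : R).

Lemma curve_length_le c L : 0 <= L -> (forall s t, mdist (c s) (c t) <= `|s - t|) ->
  (curve_length 0 L c <= L%:E)%E.
Proof.
move=> L0 h; apply: ub_ereal_sup => _ [s hs <-]; rewrite lee_fin /=.
have vL : variation 0 L idfun s = L.
  by rewrite nondecreasing_variation//= ?subr0// => x y _ _.
rewrite -[X in _ <= X]vL; apply: ler_sum => n _; rewrite distrC; exact: h.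
Qed.

(** Precomposing with the retraction of the line onto [[0, L]] makes [c] Lipschitz everywhere, hence
    continuous and of length at most [L]. *)
Lemma short_path_rectifiable c L : 0 <= L -> short_path c L ->
  exists gamma : rectifiable_curve X, [/\ rc_start gamma = 0, rc_end gamma = L,
    (rc_length gamma <= L%:E)%E & forall t, 0 <= t <= L -> rc_map gamma t = c t].
Proof.
move=> L0 h; pose clamp t := Num.max 0 (Num.min L t).
have clampE t : 0 <= t <= L -> clamp t = t.
  by move=> /andP[t0 tL]; rewrite /clamp (min_idPr tL) (max_idPr t0).
have clamp_itv t : 0 <= clamp t <= L.
  by rewrite /clamp le_max lexx ge_max L0 ge_min lexx.
have lip s t : mdist (c (clamp s)) (c (clamp t)) <= `|s - t|.
  apply: le_trans (h _ _ (clamp_itv s) (clamp_itv t)) _.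
  have cases x : [\/ clamp x = 0 /\ x <= 0, clamp x = x | clamp x = L /\ L <= x].
    rewrite /clamp; have [xL|/ltW Lx] := leP x L; last first.
      by rewrite (max_idPr L0); constructor 3.
    by have [x0|/ltW x0] := leP 0 x; [constructor 2|constructor 1].
  have := clamp_itv s; have := clamp_itv t.
  by case: (cases s) => [[-> ?]|->|[-> ?]]; case: (cases t) => [[-> ?]|->|[-> ?]];
    norm_lra.
have cont : {within `[0, L], continuous (c \o clamp)}.
  apply: continuous_subspaceT => x; apply/cvg_ballP => e e0.
  apply/nbhs_ballP; exists e => //= y; rewrite ballEmdist /ball /= => xy.
  exact: le_lt_trans (lip _ _) xy.
have len := curve_length_le L0 lip.
have rect : (curve_length 0 L (c \o clamp) < +oo)%E by apply: le_lt_trans len (ltry _).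
exists (RectifiableCurve L0 cont rect); split=> //= t ht.
by rewrite clampE.
Qed.

Lemma detour_bound_of_pi : (10%:E < space_pi X)%E ->
  exists N r1, 10 < N /\ detour_bound X N r1.
Proof.
move=> /ereal_sup_gt [_ [L1 _ <-]]; set m := ereal_inf _ => m10.
(* The infimum [m] may be infinite; then any number above 10 will do. *)
have [N N10 Nm] : exists2 N : R, 10 < N & (N%:E <= m)%E.
  case: m m10 => [x||] //= x10; first by exists x.
  by exists 11; [lra|rewrite leey].
exists N, (`|L1| + 1); split => // g r c L r1r L0 hg hc c0 cL far.
have r0 : 0 < r by move: r1r; norm_lra.
have r20 : 0 <= 2 * r by lra.
have hg' : forall s t, s \in `[0, 2 * r] -> t \in `[0, 2 * r] ->
    mdist (g s) (g t) = `|s - t|.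
  by move=> s t; rewrite !in_itv/=; apply: hg.
pose I := GeodesicInterval r20 hg'.
have rI : gi_radius I = r by rewrite /gi_radius /=; field.
have [gamma [g0 gL glen gE]] := short_path_rectifiable L0 hc.
have dI : detours I gamma.
  split.
  - by rewrite g0 gE ?c0//; lra.
  - by rewrite gL gE ?cL//; lra.
  - apply/seteqP; split => // _ [[t + <-]]; rewrite /= g0 gL in_itv/= => ht.
    rewrite /gi_ball /gi_midpoint rI ballEmdist/= gE// => lt.
    by have := far t ht; rewrite leNgt lt.
have mI : (m <= interval_pi I)%E.
  by apply: ereal_inf_lbound; exists I => //=; move: r1r; norm_lra.
have : (interval_pi I <= L%:E * (r^-1)%:E)%E.
  rewrite /interval_pi rI; apply: lee_wpmul2r; first by rewrite lee_fin invr_ge0 ltW.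
  by apply: le_trans glen; apply: ereal_inf_lbound; exists gamma.
move=> /(le_trans mI)/(le_trans Nm); rewrite -EFinM lee_fin.
by rewrite ler_pdivlMr.
Qed.

End Detours.

(** * Existence of geodesics in a metric graph *)

Section GraphGeodesics.
Context {R : realType} {G : connected_graph}.
Implicit Types (p q : metric_graph R G) (e : edge G) (s t : R).

(** Vertices may have infinite degree, so compactness cannot provide shortest paths. *)
Definition attained p q := exists2 l, pl_path p l q & pl_length l = path_dist p q.

Lemma pl_length1 e s t : pl_length [:: (e, s, t)] = `|s - t|.
Proof. by rewrite /pl_length big_seq1. Qed.

Lemma pl_path1 e s t : 0 <= s <= 1 -> 0 <= t <= 1 ->
  pl_path (edge_pt e s) [:: (e, s, t)] (edge_pt e t).
Proof. by []. Qed.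

Lemma path_dist_edge e s t : 0 <= s <= 1 -> 0 <= t <= 1 ->
  path_dist (edge_pt e s) (edge_pt e t) <= `|s - t|.
Proof.
by move=> hs ht; rewrite -(pl_length1 e); apply: path_dist_le; apply: pl_path1.
Qed.

Lemma attained_sym p q : attained p q -> attained q p.
Proof.
move=> [l /pl_path_rev[l' h' ll'] hl].
by exists l' => //; rewrite ll' hl path_dist_sym.
Qed.

(* The least integer bounding the length of some path from [v] to [w] is
   1-Lipschitz in [w], hence it is at most the distance. *)
Lemma attained_vertices (v w : vertex G) : attained (Vertex R v) (Vertex R w).
Proof.
pose P x n := exists2 l, pl_path (Vertex R v) l (Vertex R x) & pl_length l <= n%:R.
have minP x : exists n, P x n /\ forall n', P x n' -> (n <= n')%N.
  have exP : exists n, `[< P x n >].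
    have [l hl] := pl_path_ex (Vertex R v) (Vertex R x).
    exists (Num.trunc (pl_length l)).+1; apply/asboolP; exists l => //.
    by rewrite ltW// truncnS_gt.
  exists (ex_minn exP); case: ex_minnP => n /asboolP Pn nmin; split => // n' Pn'.
  by apply: nmin; apply/asboolP.
have [d hd] := boolp.choice minP.
have dv : d v = 0%N.
  apply/eqP; rewrite -leqn0; apply: (hd v).2; exists [::] => //.
  by rewrite /pl_length big_nil.
have de e : (d (tgt e) <= (d (src e)).+1)%N /\ (d (src e) <= (d (tgt e)).+1)%N.
  split.
    have [l hl ln] := (hd (src e)).1; apply: (hd _).2.
    exists (l ++ [:: (e, 0, 1)]); last first.
      by rewrite pl_length_cat pl_length1 -natr1; norm_lra.
    apply: pl_path_cat hl _.
    by rewrite -(edge_pt0 e) -(edge_pt1 e); apply: pl_path1; rewrite !lexx !ler01.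
  have [l hl ln] := (hd (tgt e)).1; apply: (hd _).2.
  exists (l ++ [:: (e, 1, 0)]); last first.
    by rewrite pl_length_cat pl_length1 -natr1; norm_lra.
  apply: pl_path_cat hl _.
  by rewrite -(edge_pt0 e) -(edge_pt1 e); apply: pl_path1; rewrite !lexx !ler01.
have deR e : (d (tgt e))%:R <= (d (src e))%:R + 1 :> R /\
    (d (src e))%:R <= (d (tgt e))%:R + 1 :> R.
  by rewrite !natr1 !ler_nat.
pose f x : R := match x with
  | Vertex x => (d x)%:R
  | Inner e u => Num.min (val u + (d (src e))%:R) (1 - val u + (d (tgt e))%:R)
  end.
have fE e : forall t, 0 <= t <= 1 -> f (edge_pt e t) =
    Num.min (t + (d (src e))%:R) (1 - t + (d (tgt e))%:R).
  have [de1 de2] := deR e.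
  apply: (edge_ptP (P := fun t x => f x =
      Num.min (t + (d (src e))%:R) (1 - t + (d (tgt e))%:R))) => //=;
    by min_lra.
have [l hl ln] := (hd w).1; exists l => //; apply/eqP.
rewrite eq_le path_dist_le// andbT; apply: le_trans ln _.
have -> : (d w)%:R = f (Vertex R w) - f (Vertex R v) by rewrite /= dv subr0.
apply: path_dist_lip => e s t s01 t01; rewrite !fE//.
by have [? ?] := deR e; min_lra.
Qed.

(* When p lies on e, T t is the length of the path from p to [edge_pt e t] inside
   e; otherwise T can be any redundant upper bound of the distance. *)
Lemma attained_inner p e (u : {t : R | 0 < t < 1}) (T : R -> R) :
  (forall w, attained p (Vertex R w)) ->
  (forall s t, 0 <= s <= 1 -> 0 <= t <= 1 -> T t - T s <= `|s - t|) ->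
  path_dist p (Vertex R (src e)) <= T 0 -> path_dist p (Vertex R (tgt e)) <= T 1 ->
  (forall v, p = Inner e v -> T (val v) <= 0) ->
  (exists2 l, pl_path p l (Inner e u) & pl_length l = T (val u)) ->
  attained p (Inner e u).
Proof.
move=> hV Tlip T0 T1 Tp [lT hT lTT].
have [lA hA lAA] := hV (src e); have [lB hB lBB] := hV (tgt e).
set A := path_dist p (Vertex R (src e)) in T0 lAA.
set B := path_dist p (Vertex R (tgt e)) in T1 lBB.
have u01 := valP u; have /andP[u0 u1] := u01.
have z01 : 0 <= (0 : R) <= 1 by rewrite lexx ler01.
have o01 : 0 <= (1 : R) <= 1 by rewrite lexx ler01.
have v01 : 0 <= val u <= 1 by lra.
have st : path_dist (Vertex R (src e)) (Vertex R (tgt e)) <= 1.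
  have := path_dist_edge e z01 o01.
  by rewrite edge_pt0 edge_pt1 sub0r normrN normr1.
have AB : A <= B + 1.
  apply: le_trans (path_dist_triangle (Vertex R (tgt e)) _ _) _.
  by rewrite lerD2l path_dist_sym.
have BA : B <= A + 1.
  by apply: le_trans (path_dist_triangle (Vertex R (src e)) _ _) _; rewrite lerD2l.
(* The best of three routes: through the source, through the target, or the one given by [T]. The
   function [h], equal to [m] on [e] and to the distance elsewhere, is 1-Lipschitz and at most 0 at
   [p], so it is bounded by the distance to [p]. *)
pose m t := Num.min (Num.min (t + A) (1 - t + B)) (T t).
pose h x := match x with
  | Vertex _ => path_dist p x
  | Inner e' v => if `[< e' = e >] then m (val v) else path_dist p x
  end.
have hE t : 0 <= t <= 1 -> h (edge_pt e t) = m t.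
  apply: (edge_ptP (P := fun t x => h x = m t)) => [||v] /=.
  - by rewrite -/A /m add0r subr0; min_lra.
  - by rewrite -/B /m subrr add0r; min_lra.
  - by rewrite asboolT.
have hE' e' t : e' <> e -> 0 <= t <= 1 -> h (edge_pt e' t) = path_dist p (edge_pt e' t).
  move=> ne; apply: (edge_ptP (P := fun t x => h x = path_dist p x)) => [||v] //=.
  by rewrite asboolF.
have hlip e' s t : 0 <= s <= 1 -> 0 <= t <= 1 ->
    h (edge_pt e' t) - h (edge_pt e' s) <= `|s - t|.
  move=> s01 t01; have [->|ne] := pselect (e' = e).
    rewrite !hE// /m; apply: minB_le; [apply: minB_le|exact: Tlip].
      by clear; norm_lra.
    by clear; norm_lra.
  rewrite !hE'// lerBlDl; apply: le_trans (path_dist_triangle (edge_pt e' s) _ _) _.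
  by rewrite lerD2l path_dist_edge.
have hp : h p <= 0.
  case: p Tp @A @B @m @h {hV hA hB hT lAA lBB T0 T1 AB BA hE hE' hlip} => [v|e' v] Tp A B m h /=.
    by rewrite path_distxx.
  case: asboolP => [ee'|_]; last by rewrite path_distxx.
  by rewrite /m ge_min Tp ?orbT// ee'.
have mu : m (val u) <= path_dist p (Inner e u).
  have := path_dist_lip p (Inner e u) hlip.
  have -> : h (Inner e u) = m (val u) by rewrite /= asboolT.
  lra.
suff [l hl lm] : exists2 l, pl_path p l (Inner e u) & pl_length l = m (val u).
  by exists l => //; apply/eqP; rewrite eq_le path_dist_le// lm mu.
have pA : exists2 l, pl_path p l (Inner e u) & pl_length l = val u + A.
  exists (lA ++ [:: (e, 0, val u)]).
    apply: pl_path_cat hA _; rewrite -(edge_pt0 e) -(edge_pt_inner e u).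
    exact: pl_path1.
  by rewrite pl_length_cat pl_length1 lAA; norm_lra.
have pB : exists2 l, pl_path p l (Inner e u) & pl_length l = 1 - val u + B.
  exists (lB ++ [:: (e, 1, val u)]).
    apply: pl_path_cat hB _; rewrite -(edge_pt1 e) -(edge_pt_inner e u).
    exact: pl_path1.
  by rewrite pl_length_cat pl_length1 lBB; norm_lra.
by rewrite /m; case: leP => _; [case: leP => _|exists lT].
Qed.

(** If [p] and [q] lie inside the same edge, [T] measures the segment between them; otherwise it
    repeats the route through the source. *)
Lemma attained_extend p : (forall w, attained p (Vertex R w)) -> forall q, attained p q.
Proof.
move=> hV [//|e u]; have /andP[u0 u1] := valP u.
have z01 : 0 <= (0 : R) <= 1 by rewrite lexx ler01.
have o01 : 0 <= (1 : R) <= 1 by rewrite lexx ler01.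
have v01 : 0 <= val u <= 1 by lra.
have [[v pv]|nv] := pselect (exists v, p = Inner e v).
  have /andP[v0 v1] := valP v; have w01 : 0 <= val v <= 1 by lra.
  apply: (@attained_inner _ _ _ (fun t => `|val v - t|)) => //.
  - by move=> s t _ _; norm_lra.
  - rewrite pv -(edge_pt_inner e v) -(edge_pt0 e); exact: path_dist_edge.
  - rewrite pv -(edge_pt_inner e v) -(edge_pt1 e); exact: path_dist_edge.
  - by rewrite pv => v' [->]; rewrite subrr normr0.
  - exists [:: (e, val v, val u)]; last by rewrite pl_length1.
    by rewrite pv -!(edge_pt_inner e); exact: pl_path1.
apply: (@attained_inner _ _ _ (fun t => t + path_dist p (Vertex R (src e)))) => //.
- by move=> s t _ _; norm_lra.
- by rewrite add0r.
- apply: le_trans (path_dist_triangle (Vertex R (src e)) _ _) _.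
  rewrite addrC lerD2r -(edge_pt0 e) -(edge_pt1 e).
  by apply: le_trans (path_dist_edge _ z01 o01) _; norm_lra.
- by move=> v pv; case: nv; exists v.
- have [lA hA lAA] := hV (src e).
  exists (lA ++ [:: (e, 0, val u)]).
    apply: pl_path_cat hA _; rewrite -(edge_pt0 e) -(edge_pt_inner e u).
    exact: pl_path1.
  by rewrite pl_length_cat pl_length1 lAA; norm_lra.
Qed.

Lemma path_dist_attained p q : attained p q.
Proof.
apply: attained_extend => w; apply: attained_sym.
by apply: attained_extend; exact: attained_vertices.
Qed.

Lemma joined_pl_path p l q : pl_path p l q ->
  joined (X := metric_graph R G) setT p q (pl_length l).
Proof.
elim: l p => [p /= ->|[[e s] t] l ih p /= [s01 t01 -> /ih h]].
  rewrite /pl_length big_nil; exists (fun=> q); split => // s t _ _.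
  by rewrite mdistxx.
rewrite /pl_length big_cons /=; apply: joined_cat h.
apply: (joined_sub (L := 1)) => // s' t'; exact: path_dist_edge.
Qed.

(** A shortest piecewise linear path, run at unit speed, is 1-Lipschitz with no excess length. *)
Lemma metric_graph_geodesic p q : exists g : R -> metric_graph R G,
  [/\ geodesic g (mdist p q), g 0 = p & g (mdist p q) = q].
Proof.
have [l /joined_pl_path[c [l0 hc c0 cl _]] e] := path_dist_attained p q.
have {}e : pl_length l = mdist p q by [].
rewrite e in l0 hc cl; exists c; split => //.
by apply: short_path_geodesic => //; rewrite c0 cl.
Qed.

End GraphGeodesics.

Theorem theorem1 (R : realType) (G : connected_graph) :
  (10%:E < space_pi (metric_graph R G))%E ->
  gromov_hyperbolic (metric_graph R G).
Proof.
move=> /detour_bound_of_pi[N [r1 [N10 HN]]].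
exact: (detour_bound_hyperbolic (@metric_graph_geodesic R G) HN N10).
Qed.
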